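(* Let $\Sigma$ be a shuffling method such that $\Pi_{\Sigma}^{k}\subseteq IP_k$ for every $k\ge 2$, and let $b_k = |\Pi_{\Sigma}^{k}|$. Then for every $n\ge 1$, $$p_n(\mathbb{Q}_{\Sigma}^{\prime}) = 1 + \sum_{\substack{k_1+\cdots+k_l = n-u\\ k_i\ge 2,\ u\ge 0}} \binom{u+l}{l}\prod_{j=1}^{l} b_{k_j},$$ where the sum is over all $l\ge 1$, all integers $u\ge 0$, and all sequences $(k_1,\dots,k_l)$ of integers $k_i\ge 2$ with $k_1+\cdots+k_l=n-u$.
   Context: Permutations are written in one-line notation; $S_n$ is the set of permutations of $[n]=\{1,\dots,n\}$, $id_n = 12\cdots n$, and $\varepsilon$ is the empty sequence. $IP_n$ is the set of irreducible permutations of size $n$: those $\pi\in S_n$ with $\pi([j])\ne [j]$ for every $0<j<n$. A shuffling method $\Sigma$ is a family of sets $\Pi_{\Sigma}^{n}\subseteq S_n$, $n\ge 2$, with $id_n\notin\Pi_{\Sigma}^{n}$ for all $n\geq 2$. The device $\mathbb{Q}_{\Sigma}^{\prime}$ processes configurations $(s_{inp},s_{dev},s_{out})$ of three sequences (input, content of the device, output), starting from $(\pi,\varepsilon,\varepsilon)$ and ending at $(\varepsilon,\varepsilon,\pi')$, using freely chosen operations: push (move the first element of the input to the end of $s_{dev}$); pop (move the first element of $s_{dev}$ to the end of the output); shuffle (if $s_{dev}=s_1\cdots s_m$ with $m\ge2$, choose $\sigma\in\Pi_{\Sigma}^{m}$ and replace the content by $s_{\sigma(1)}\cdots s_{\sigma(m)}$),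 where immediately after each shuffle the entire content of the device must be unloaded, i.e. appended in order to the output, leaving the device empty. $p_n(\mathbb{Q}_{\Sigma}^{\prime})$ is the number of $\pi\in S_n$ for which the final output $\pi'=id_n$ can be achieved. *)

(* Defs.v *)
From Stdlib Require Import Relation_Operators.
From HB Require Import structures.
From mathcomp Require Import all_boot all_fingroup.
From mathcomp Require Import boolp.

Set Implicit Arguments.
Unset Strict Implicit.
Unset Printing Implicit Defensive.

(* [n] is represented by 'I_n = {0, .., n-1}, so [j] is the set of i < j. *)
Definition irreducible n (p : 'S_n) : bool :=
  [forall j : 'I_n, (0 < j) ==>
     (p @: [set i : 'I_n | i < j] != [set i : 'I_n | i < j])].

Definition IP n : {set 'S_n} := [set p | irreducible p].

(* The sets at n = 0 and n = 1 are unconstrained; the device never uses them. *)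
Record shuffling_method := ShufflingMethod {
  shuffles :> forall n : nat, {set 'S_n};
  id_notin_shuffles : forall n : nat, 2 <= n -> (1%g : 'S_n) \notin shuffles n
}.

Definition one_line n (p : 'S_n) : seq 'I_n := [seq p i | i <- enum 'I_n].

Definition apply_shuffle (T : Type) m (p : 'S_m) (s : m.-tuple T) : seq T :=
  [seq tnth s (p i) | i <- enum 'I_m].

(* (input, content of the device, output) *)
Definition config (T : Type) : Type := (seq T * seq T * seq T)%type.

(* A shuffle and the unloading that must immediately follow it form a single
   step, so that no other operation can come between them. *)
Inductive step (Sigma : shuffling_method) (T : Type) : config T -> config T -> Prop :=
| Push x inp dev out :
    step Sigma (x :: inp, dev, out) (inp, rcons dev x, out)
| Pop x inp dev out :
    step Sigma (inp, x :: dev, out) (inp, dev, rcons out x)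
| ShuffleUnload m (p : 'S_m) inp (dev : m.-tuple T) out :
    2 <= m -> p \in Sigma m ->
    step Sigma (inp, tval dev, out) (inp, [::], out ++ apply_shuffle p dev).

Definition can_output (Sigma : shuffling_method) (T : Type) (s t : seq T) : Prop :=
  clos_refl_trans (config T) (@step Sigma T) (s, [::], [::]) ([::], [::], t).

Definition num_sortable (Sigma : shuffling_method) (n : nat) : nat :=
  #|[set p : 'S_n | `[< can_output Sigma (one_line p) (one_line (1%g : 'S_n)) >]]|.

(* Main.v *)
Require Import Defs.
From Stdlib Require Import Relation_Operators Operators_Properties.
From HB Require Import structures.
From mathcomp Require Import all_boot all_fingroup all_algebra.
From mathcomp Require Import boolp.

(** The device is a queue that is emptied by every shuffle, so a run cuts the
    input into consecutive blocks: a single entry that is pushed and popped, or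
    a string of k >= 2 entries that is loaded, shuffled by some sigma in Sigma k
    and unloaded ([can_outputE]).  A block of length k comes out as
    a, a+1, .., a+k-1 exactly when it went in as the word of sigma^-1 shifted by
    a ([apply_shuffle_iota]).  Hence the sortable permutations are the direct
    sums of copies of the permutation 1 of size 1 and of inverses of shuffles.

    Shuffles are irreducible, and therefore the cut into blocks is determined by
    the permutation: if two cuts had first blocks of lengths k1 < k2, then the
    longer block would send its first k1 positions to themselves
    ([block_word_prefix_reducible]).  So sortable permutations are counted by
    sequences of blocks.  With B the polynomial whose coefficient of X^k is
    #|Sigma k| for k >= 2, the sequences of m blocks of total length n are counted
    by the coefficient of X^n in (X + B)^m ([size_sortable_words]).  Expanding
    (X + B)^m by the binomial theorem gives the terms 'C(u + l, l) X^u B^l, in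
    which l counts the shuffled blocks and u the single entries
    ([coef_geometric_sum]); the summand l = 0 is the leading 1 of the formula. *)

Set Implicit Arguments.
Unset Strict Implicit.
Unset Printing Implicit Defensive.
Import GRing.Theory.

(** * Runs of the device as sequences of blocks *)

(** A single entry that is pushed and popped behaves as a block of length 1
    rearranged by the identity, so that all blocks can be treated alike. *)
Definition blocks (Sigma : shuffling_method) k : {set 'S_k} :=
  if k == 1 then [set 1%g] else Sigma k.

Inductive rearranges (Sigma : shuffling_method) (T : Type) :
    seq T -> seq T -> Prop :=
| RearrangesNil : rearranges Sigma [::] [::]
| RearrangesBlock k (p : 'S_k) (dev : k.-tuple T) s t :
    0 < k -> p \in blocks Sigma k -> rearranges Sigma s t ->
    rearranges Sigma (dev ++ s) (apply_shuffle p dev ++ t).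

Lemma rearranges_cons Sigma (T : Type) (x : T) s t :
  rearranges Sigma s t -> rearranges Sigma (x :: s) (x :: t).
Proof.
have p1 : (1%g : 'S_1) \in blocks Sigma 1 by rewrite inE.
move=> /(RearrangesBlock [tuple x] (ltn0Sn 0) p1).
by rewrite /apply_shuffle enum_ordSl enum_ord0 /= perm1.
Qed.

(** The entries in the device at a given time, followed by the remaining input,
    are what the rest of the run still has to rearrange. This reading makes a
    push invisible, a pop a block of length 1, and a shuffle a longer block. *)
Lemma run_rearranges Sigma (T : Type) (c d : config T) :
  clos_refl_trans _ (@step Sigma T) c d -> d.1 = ([::], [::]) ->
  exists2 t, d.2 = c.2 ++ t & rearranges Sigma (c.1.2 ++ c.1.1) t.
Proof.
move/(@clos_rt_rt1n _ _ _ _); elim=> [[[inp dev] out] /= [-> ->]|].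
  by exists [::]; [rewrite cats0 | constructor].
move=> c1 c2 c3 c12 _ IH /IH [t]; case: c12 => {IH c1 c2}.
- by move=> x inp dev out /= -> ?; exists t; rewrite // -cat_rcons.
- move=> x inp dev out /= -> rt; exists (x :: t); first by rewrite cat_rcons.
  exact: rearranges_cons.
- move=> m p inp dev out m_ge2 pS /= -> rt.
  exists (apply_shuffle p dev ++ t); first by rewrite catA.
  constructor=> //; first exact: ltnW.
  by rewrite /blocks gtn_eqF.
Qed.

Lemma run_push Sigma (T : Type) (s inp dev out : seq T) :
  clos_refl_trans _ (@step Sigma T) (s ++ inp, dev, out) (inp, dev ++ s, out).
Proof.
elim: s dev => [|x s IH] dev; first by rewrite cats0; apply: rt_refl.
rewrite -cat_rcons; apply: rt_trans (IH _).
by apply: rt_step; constructor.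
Qed.

Lemma rearranges_run Sigma (T : Type) (s t out : seq T) :
  rearranges Sigma s t ->
  clos_refl_trans _ (@step Sigma T) (s, [::], out) ([::], [::], out ++ t).
Proof.
move=> rst; elim: rst out => [|k p dev {}s {}t k_gt0 pS _ IH] out.
  by rewrite cats0; apply: rt_refl.
apply: rt_trans (run_push _ _ _ _ _) _; rewrite catA.
apply: rt_trans (IH _) => /=; apply: rt_step.
move: pS; rewrite /blocks; case: eqP => [k1|kn1 pS]; last first.
  by apply: ShuffleUnload => //; case: (k) k_gt0 kn1 => [|[]].
subst k; rewrite inE => /eqP ->; case/tupleP: dev => x dev; rewrite (tuple0 dev).
rewrite /apply_shuffle enum_ordSl enum_ord0 /= perm1 cats1; exact: Pop.
Qed.

Lemma can_outputE Sigma (T : Type) (s t : seq T) :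
  can_output Sigma s t <-> rearranges Sigma s t.
Proof.
split=> [/run_rearranges/(_ erefl) [u /= ->] // | /rearranges_run]; exact.
Qed.

Lemma rearranges_map Sigma (T U : Type) (f : T -> U) s t :
  rearranges Sigma s t -> rearranges Sigma (map f s) (map f t).
Proof.
elim=> [|k p dev {}s {}t k_gt0 pS _ IH]; first by constructor.
have -> : map f (apply_shuffle p dev ++ t)
        = apply_shuffle p (map_tuple f dev) ++ map f t.
  rewrite map_cat -map_comp; congr (_ ++ _).
  by apply: eq_map => i /=; rewrite tnth_map.
by rewrite map_cat; apply: (RearrangesBlock (map_tuple f dev)).
Qed.

(** * The words that the device sorts *)

(** The only block that p rearranges into a, a+1, .., a+k-1. *)
Definition block_word a k (p : 'S_k) : seq nat :=
  [seq a + p^-1%g i | i <- enum 'I_k].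

Lemma size_block_word a k (p : 'S_k) : size (block_word a p) = k.
Proof. by rewrite size_map size_enum_ord. Qed.

Lemma nth_block_word a k (p : 'S_k) (i : 'I_k) :
  nth 0 (block_word a p) i = a + p^-1%g i.
Proof. by rewrite (nth_map i) ?size_enum_ord // nth_ord_enum. Qed.

Lemma block_word_inj a k : injective (@block_word a k).
Proof.
move=> p q epq; apply: invg_inj; apply/permP => i; apply: val_inj.
by apply: (@addnI a); rewrite -!nth_block_word epq.
Qed.

Lemma iotaE a k : iota a k = [seq a + val i | i <- enum 'I_k].
Proof. by rewrite (map_comp (addn a) val) val_enum_ord -iotaDl addn0. Qed.

Lemma apply_shuffle_iota a k (p : 'S_k) (dev : k.-tuple nat) :
  apply_shuffle p dev = iota a k <-> val dev = block_word a p.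
Proof.
rewrite iotaE /apply_shuffle; split=> [/eq_in_map e | e].
  apply: (@eq_from_nth _ 0) => [|i]; rewrite size_tuple ?size_block_word // => lti.
  rewrite (nth_block_word a p (Ordinal lti)) -(tnth_nth 0 dev (Ordinal lti)).
  by rewrite -[in LHS](permKV p (Ordinal lti)) e ?mem_enum.
apply: eq_map => i; rewrite (tnth_nth 0) e nth_block_word; by rewrite permK.
Qed.

(** Sortable words are described by their first block; the remainder has to be
    sorted into the interval of values that follows. *)
Lemma rearranges_iota Sigma a n s :
  rearranges Sigma s (iota a n) <->
  (n = 0 /\ s = [::]) \/
  exists k (p : 'S_k) w, [/\ 0 < k <= n, p \in blocks Sigma k,
    rearranges Sigma w (iota (a + k) (n - k)) & s = block_word a p ++ w].
Proof.
split; last first.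
  case=> [[-> ->]|[k [p [w [/andP[k_gt0 lekn] pS rw ->]]]]]; first by constructor.
  have /eqP szw := size_block_word a p; rewrite -(subnKC lekn) iotaD.
  have /apply_shuffle_iota <- : val (Tuple szw) = block_word a p by [].
  by apply: (RearrangesBlock (Tuple szw)).
move et: (iota a n) => t rst; case: rst et => [|k p dev {}s {}t k_gt0 pS rst et].
  by case: n => // _; left.
right; have szp : size (apply_shuffle p dev) = k by rewrite size_map size_enum_ord.
have lekn : k <= n by rewrite -(size_iota a n) et size_cat szp leq_addr.
move: et; rewrite -{1}(subnKC lekn) iotaD => /eqP.
rewrite eqseq_cat ?size_iota ?szp // => /andP[/eqP/esym/apply_shuffle_iota e /eqP et].
by exists k, p, s; rewrite k_gt0 lekn et e.
Qed.

(** [W k] lists the possible remainders after a first block of length k. *)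
Definition prepend_block (Sigma : shuffling_method) a n
    (W : nat -> seq (seq nat)) : seq (seq nat) :=
  [seq block_word a y.1 ++ y.2 | k <- iota 1 n,
     y <- [seq (p, w) | p <- enum (blocks Sigma k), w <- W k]].
Arguments prepend_block : simpl never.

Lemma prepend_blockP Sigma a n W s :
  reflect (exists k (p : 'S_k) w,
    [/\ 0 < k <= n, p \in blocks Sigma k, w \in W k & s = block_word a p ++ w])
    (s \in prepend_block Sigma a n W).
Proof.
apply: (iffP (@allpairsPdep _ (fun k => ('S_k * seq nat)%type) _ _ _ _ _)).
  case=> k [_ [kn /allpairsP[[p w] /= [pS ws ->]] ->]]; exists k, p, w.
  by move: kn pS; rewrite mem_iota add1n ltnS mem_enum.
case=> k [p [w [kn pS ws ->]]]; exists k, (p, w); split=> //.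
  by rewrite mem_iota add1n ltnS.
by apply/allpairsP; exists (p, w); rewrite mem_enum.
Qed.

(** [N] bounds the depth of the recursion; the enumeration is complete as soon
    as n <= N. *)
Fixpoint sortable_words (Sigma : shuffling_method) N a n : seq (seq nat) :=
  if N is N'.+1 then
    if n is 0 then [:: [::]] else
    prepend_block Sigma a n (fun k => sortable_words Sigma N' (a + k) (n - k))
  else [:: [::]].

Lemma mem_sortable_words Sigma N a n s : n <= N ->
  s \in sortable_words Sigma N a n <-> rearranges Sigma s (iota a n).
Proof.
elim: N a n s => [|N IH] a [|n] s leN; rewrite ?rearranges_iota /=; try by [].
- by rewrite inE; split=> [/eqP->|[[_ ->]|[[|k] [p [w []]]]]] //; left.
- by rewrite inE; split=> [/eqP->|[[_ ->]|[[|k] [p [w []]]]]] //; left.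
have leNk k : 0 < k <= n.+1 -> n.+1 - k <= N.
  by case/andP=> k_gt0 _; rewrite leq_subLR (leq_trans leN) // -add1n leq_add.
split=> [/prepend_blockP|[[]//|]] [k [p [w [kn pS ws ->]]]].
  by right; exists k, p, w; split=> //; apply/(IH _ _ _ (leNk k kn)).
by apply/prepend_blockP; exists k, p, w; split=> //; apply/(IH _ _ _ (leNk k kn)).
Qed.

(** * Uniqueness of the block decomposition *)

(** The positions below k1 of both words carry the same values, which for the
    first word are a, .., a+k1-1. Hence the inverse of p2, and so p2 itself,
    preserves the proper initial segment of length k1. *)
Lemma block_word_prefix_reducible a k1 k2 (p1 : 'S_k1) (p2 : 'S_k2) w1 w2 :
  0 < k1 < k2 -> block_word a p1 ++ w1 = block_word a p2 ++ w2 ->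
  ~~ irreducible p2.
Proof.
move=> /andP[k1_gt0 lt12] e.
have inv_small (i : 'I_k2) : i < k1 -> p2^-1%g i < k1.
  move=> lti; have := congr1 (nth 0 ^~ i) e.
  rewrite !nth_cat !size_block_word lti ltn_ord nth_block_word.
  by rewrite (nth_block_word a p1 (Ordinal lti)) => /addnI <-.
rewrite negb_forall; apply/existsP; exists (Ordinal lt12).
rewrite negb_imply k1_gt0 negbK /=; set I := [set _ | _].
have eI : p2^-1%g @: I = I.
  apply/eqP; rewrite eqEcard card_imset ?leqnn ?andbT; last exact: perm_inj.
  by apply/subsetP => _ /imsetP[i + ->]; rewrite !inE => /inv_small.
by rewrite -{1}eI -imset_comp (eq_imset (g := id)) ?imset_id // => i; rewrite /= permKV.
Qed.

Lemma irreducible_blocks (Sigma : shuffling_method) k (p : 'S_k) :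
  (forall k : nat, 2 <= k -> Sigma k \subset IP k) ->
  0 < k -> p \in blocks Sigma k -> irreducible p.
Proof.
move=> S_irr k_gt0; rewrite /blocks; case: eqP => [k1 _|kn1 pS].
  by subst k; apply/forallP => -[[]].
have /S_irr/subsetP/(_ p pS) : 2 <= k by case: (k) k_gt0 kn1 => [|[]].
by rewrite inE.
Qed.

Lemma uniq_prepend_block (Sigma : shuffling_method) a n W :
  (forall k : nat, 2 <= k -> Sigma k \subset IP k) -> (forall k, uniq (W k)) ->
  uniq (prepend_block Sigma a n W).
Proof.
move=> S_irr uniqW.
apply: allpairs_uniq_dep => [|k _|]; first exact: iota_uniq.
  by apply: allpairs_uniq; rewrite ?enum_uniq ?uniqW // => -[? ?] [? ?].
pose memP := @allpairsPdep _ (fun k => ('S_k * seq nat)%type : eqType).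
have firstP k (p : 'S_k) w : k \in iota 1 n ->
    (p, w) \in [seq (p, w) | p <- enum (blocks Sigma k), w <- W k] ->
  0 < k /\ irreducible p.
  rewrite mem_iota => /andP[k_gt0 _] /allpairsP[[q v] /= [qS _ [-> _]]].
  by split=> //; apply: irreducible_blocks S_irr k_gt0 _; rewrite -mem_enum.
move=> u1 u2 /memP [k1 [[p1 w1] [k1n /(firstP _ _ _ k1n)[k1_gt0 p1I] ->]]].
move=> /memP [k2 [[p2 w2] [k2n /(firstP _ _ _ k2n)[k2_gt0 p2I] ->]]] /= e.
have k1_eq_k2 : k1 = k2.
  apply/eqP; case: ltngtP => // lt; [move: p2I | move: p1I]; apply: contraLR => _.
    by apply: block_word_prefix_reducible e; rewrite k1_gt0.
  by apply: block_word_prefix_reducible (esym e); rewrite k2_gt0.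
subst k2; move/eqP: e; rewrite eqseq_cat ?size_block_word //.
by move=> /andP[/eqP/block_word_inj -> /eqP ->].
Qed.

Lemma uniq_sortable_words (Sigma : shuffling_method) N a n :
  (forall k : nat, 2 <= k -> Sigma k \subset IP k) ->
  uniq (sortable_words Sigma N a n).
Proof.
move=> S_irr; elim: N a n => [|N IH] a [|n] //.
exact: uniq_prepend_block.
Qed.

(** * From permutations to words *)

Lemma rearranges_perm_eq Sigma (T : eqType) (s t : seq T) :
  rearranges Sigma s t -> perm_eq s t.
Proof.
elim=> [|k p dev {}s {}t _ _ _ IH] //; apply: perm_cat => //.
rewrite perm_sym; apply/tuple_permP; exists p.
by rewrite /apply_shuffle.
Qed.

Lemma num_sortableE (Sigma : shuffling_method) n :
  (forall k : nat, 2 <= k -> Sigma k \subset IP k) -> 0 < n ->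
  num_sortable Sigma n = size (sortable_words Sigma n 0 n).
Proof.
move=> S_irr; case: n => // n _; set n1 := n.+1.
pose g (p : 'S_n1) := map val (one_line p).
have g_inj : injective g.
  move=> p q /(inj_map val_inj)/eq_in_map e; apply/permP => i.
  by apply: e; rewrite mem_enum.
have inordK_map (s : seq 'I_n1) : map (@inord n) (map val s) = s.
  by rewrite -map_comp map_id_in // => i _ /=; rewrite inord_val.
have line1 : one_line (1%g : 'S_n1) = enum 'I_n1.
  by rewrite /one_line map_id_in // => i _; rewrite perm1.
rewrite /num_sortable cardE -(size_map g); apply: perm_size; apply: uniq_perm.
- by rewrite map_inj_uniq ?enum_uniq.
- exact: uniq_sortable_words.
move=> w; apply/mapP/idP => [[p + ->]|].
  rewrite mem_enum inE => /asboolP/can_outputE/(rearranges_map val).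
  by rewrite line1 val_enum_ord => /mem_sortable_words; apply.
move/mem_sortable_words => /(_ (leqnn _)) rw.
have := rearranges_map (@inord n) rw; rewrite -val_enum_ord inordK_map => ri.
(* A word that can be sorted is a rearrangement of the sorted word, hence the
   one-line notation of some permutation. *)
have /tuple_permP[p ep] : perm_eq (map (@inord n) w) (ord_tuple n1).
  have -> : tval (ord_tuple n1) = enum 'I_n1 := val_ord_tuple n1.
  exact: rearranges_perm_eq ri.
have ew : map (@inord n) w = one_line p.
  by rewrite ep /=; apply: eq_map => i; rewrite tnth_ord_tuple.
exists p; last first.
  rewrite /g -ew -map_comp map_id_in // => i iw /=; rewrite inordK //.
  by have := perm_mem (rearranges_perm_eq rw) i; rewrite iw mem_iota => /esym.
by rewrite mem_enum inE; apply/asboolP/can_outputE; rewrite -ew line1.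
Qed.

(** * Counting sequences of blocks *)

Lemma size_prepend_block Sigma a n W :
  size (prepend_block Sigma a n W)
  = \sum_(1 <= k < n.+1) #|blocks Sigma k| * size (W k).
Proof.
rewrite size_allpairs_dep sumnE big_map /index_iota subn1 /=.
by apply: eq_bigr => k _; rewrite size_allpairs -cardE.
Qed.

Section Counting.
Local Open Scope ring_scope.

Definition long_poly (b : nat -> nat) n : {poly nat} :=
  \poly_(k < n.+1) (if (2 <= k)%N then b k else 0).

(** Multiplying out the l factors means choosing one exponent k_j in each of them;
    X^u accounts for the part of n that the chosen exponents leave over. *)
Lemma coef_Xn_long_poly b n l u :
  ('X^u * long_poly b n ^+ l)`_n
  = (\sum_(k : {ffun 'I_l -> 'I_n.+1} |
                 [forall i, 2 <= k i] && (\sum_(i < l) k i + u == n))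
            \prod_(j < l) b (k j))%N.
Proof.
have -> : long_poly b n ^+ l = \prod_(j < l) long_poly b n
  by rewrite prodr_const card_ord.
rewrite /long_poly poly_def bigA_distr_bigA mulr_sumr coef_sum [RHS]big_mkcond.
apply: eq_bigr => k _; rewrite scaler_prod prodrXr -scalerAr -exprD coefZ coefXn.
rewrite eq_sym addnC; case: eqP => _; last by rewrite andbF mulr0.
rewrite andbT mulr1; case: ifP => [/forallP k_ge2|/negbT].
  by apply: eq_bigr => j _; rewrite k_ge2.
by rewrite negb_forall => /existsP[j kj]; rewrite (bigD1 j) //= (negbTE kj) mul0r.
Qed.

Lemma coef_Xn_long_poly_eq0 b n l u :
  (n < l + u)%N -> ('X^u * long_poly b n ^+ l)`_n = 0.
Proof.
move=> ltn; rewrite coef_Xn_long_poly big1 // => k /andP[/forallP k_ge2 /eqP en].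
move: ltn; rewrite -{1}en ltn_add2r ltnNge; case/negP.
rewrite -[leqLHS]card_ord -sum1_card; apply: leq_sum => i _.
exact: leq_trans (k_ge2 i).
Qed.

(** The binomial theorem, summed over the total number m = u + l of blocks. The
    square range of (l, u) on the right adds only terms with n < l + u, which
    vanish because each of the l long blocks has length at least 2. *)
Lemma coef_geometric_sum b n :
  (\sum_(m < n.+1) ('X + long_poly b n) ^+ m)`_n
  = (\sum_(l < n.+1) \sum_(u < n.+1)
       'C(u + l, l) * (('X^u * long_poly b n ^+ l)`_n)%R)%N.
Proof.
pose F m l := ('C(m, l) * (('X^(m - l) * long_poly b n ^+ l)`_n)%R)%N.
transitivity (\sum_(m < n.+1) \sum_(l < n.+1) F m l)%N.
  rewrite coef_sum; apply: eq_bigr => m _; rewrite exprDn coef_sum.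
  rewrite (big_ord_widen n.+1
    (fun l => ('X^(m - l) * long_poly b n ^+ l *+ 'C(m, l))`_n)) //.
  rewrite big_mkcond; apply: eq_bigr => l _; rewrite ltnS coefMn.
  case: leqP => [_|ltml]; last by rewrite /F bin_small.
  by rewrite -mulr_natl natn.
rewrite exchange_big; apply: eq_bigr => l _.
have leln : (l <= n)%N by rewrite -ltnS.
pose G u := ('C(u + l, l) * (('X^u * long_poly b n ^+ l)`_n)%R)%N.
rewrite -(big_mkord xpredT (F ^~ l)) -(big_mkord xpredT G).
rewrite (@big_cat_nat _ _ _ l) //=; last exact: leqW.
rewrite big_nat big1 ?add0n => [|m /andP[_ ltml]]; last by rewrite /F bin_small.
rewrite [RHS](@big_cat_nat _ _ _ (n.+1 - l)) ?leq_subr //=.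
rewrite [X in (_ + X)%N]big_nat [X in (_ + X)%N]big1 ?addn0; last first.
  move=> u /andP[leu _]; rewrite /G coef_Xn_long_poly_eq0 ?muln0 //.
  by rewrite -leq_subLR.
rewrite -{1}[l : nat]add0n big_addn; apply: eq_bigr => u _.
by rewrite /F /G addnK.
Qed.

Lemma coef_X_long_poly (Sigma : shuffling_method) M k : (0 < k <= M)%N ->
  ('X + long_poly (fun k => #|Sigma k|) M)`_k = #|blocks Sigma k|.
Proof.
case/andP=> k_gt0 lekM; rewrite coefD coefX coef_poly ltnS lekM /blocks.
case: k k_gt0 lekM => [|[|k]] //= _ _.
by rewrite cards1.
Qed.

(** Both sides obey the recursion obtained by splitting off the first block: for
    the polynomials, it reads 1 + C + .. + C^(N+1) = 1 + C (1 + C + .. + C^N).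
    The truncation degree M is kept apart from n because the recursion lowers n
    while the polynomial has to stay the same. *)
Lemma size_sortable_words (Sigma : shuffling_method) M N a n :
  (n <= N)%N -> (n <= M)%N ->
  size (sortable_words Sigma N a n)
  = (\sum_(m < N.+1) ('X + long_poly (fun k => #|Sigma k|) M) ^+ m)`_n.
Proof.
set C := 'X + _ => + lenM; elim: N a n lenM => [|N IH] a n lenM leN.
  by move: leN; rewrite leqn0 big_ord1 expr0 coef1 => /eqP ->.
have C0 : C`_0 = 0 by rewrite coefD coefX coef_poly.
rewrite big_ord_recl expr0 coefD coef1.
under eq_bigr do rewrite exprS.
rewrite -mulr_sumr coefM big_ord_recl C0 mul0r add0r.
case: n lenM leN => [|n] lenM leN; first by rewrite big_ord0.
rewrite /= size_prepend_block big_add1 big_mkord add0r; apply: eq_bigr => k _.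
have lekn := ltn_ord k.
rewrite coef_X_long_poly ?(leq_trans lekn) //.
rewrite IH // subSS; apply: leq_trans (leq_subr _ _) _ => //; exact: ltnW.
Qed.

End Counting.

(* The bounds u <= n, l <= n and k_i <= n are implied by
   k_1 + ... + k_l + u = n and k_i >= 2; they only make the ranges finite. *)
Theorem theorem3p4 (Sigma : shuffling_method)
    (S_irr : forall k : nat, 2 <= k -> Sigma k \subset IP k)
    (n : nat) (n_gt0 : 1 <= n) :
  num_sortable Sigma n =
    1 + \sum_(1 <= l < n.+1) \sum_(0 <= u < n.+1)
          \sum_(k : {ffun 'I_l -> 'I_n.+1} |
                 [forall i, 2 <= k i] && (\sum_(i < l) k i + u == n))
            'C(u + l, l) * \prod_(j < l) #|Sigma (k j)|.
Proof.
rewrite num_sortableE // (@size_sortable_words _ n) // coef_geometric_sum.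
rewrite big_ord_recl big_add1 big_mkord; congr (_ + _).
  (* Without shuffled blocks only u = n contributes: the identity permutation. *)
  rewrite (bigD1 ord_max) //= big1 => [|u /negbTE u_neq].
    by rewrite expr0 mulr1 coefXn eqxx bin0.
  by rewrite expr0 mulr1 coefXn eq_sym (u_neq : (u == n :> nat) = _) muln0.
apply: eq_bigr => l _; rewrite big_mkord; apply: eq_bigr => u _.
by rewrite coef_Xn_long_poly big_distrr.
Qed.
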